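(* Let $V$ be a finite set with $|V|\ge 2$ and let $C=(c_{xy})_{x,y\in V}$ be a real symmetric matrix whose off-diagonal entries satisfy $c_{xz}\ge\min\{c_{xy},c_{yz}\}$ for all pairwise distinct $x,y,z\in V$. For $v\in V$ let $m(v)\coloneqq\max\{c_{vw}: w\in V\setminus\{v\}\}$. Then: (1) The relation on $V$ given by $x\sim y$ if and only if $x=y$ or $m(x)=m(y)=c_{xy}$ is an equivalence relation. (2) If $x_1\sim x_2$ and $y_1\sim y_2$, then $c_{x_1y_1}=c_{x_2y_2}$; equivalently, $c_{xy}$ depends only on the equivalence classes of $x$ and $y$. (3) Let $X_1,\dots,X_k$ be the equivalence classes of $\sim$ and assume further that $c_{xx}=c_{yy}$ whenever $x\sim y$. Then the blocks $C|_{X_i\times X_j}$ form an equitable partition of $C$ with equitable quotient matrix $Q=(q_{ij})_{i,j=1,\dots,k}$, where $q_{ij}=c_{xy}|X_j|$ for $i\neq j$ (with $x\in X_i$, $y\in X_j$), and $q_{jj}=c_{xx}+m(x)(|X_j|-1)$ (with $x\in X_j$). (4) Assume in addition to the hypotheses of (3) that $C$ is nonnegative and has only zeros on its diagonal, and let $m(X_i)$ denote the common value of $m(x)$ for $x\in X_i$. Then $$\mathcal{E}(C)=\mathcal{E}(Q)+\operatorname{trace}(Q)\ge 2\sum_{i=1}^k(|X_i|-1)\,m(X_i),$$ and this inequality is an equality if and only if $Q$ has no negative eigenvalues.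
   Context: An equitable partition of a $V\times V$ matrix $C$ with respect to a partition $V=X_1\cup\dots\cup X_k$ means that each block $C|_{X_i\times X_j}$ has constant row sums $q_{ij}$; the matrix $Q=(q_{ij})$ is called the equitable quotient matrix. $\mathcal{E}(A)$ denotes the energy of a matrix $A$, i.e. the sum of the absolute values of its eigenvalues.
   Formalization: Part (2) is stated only for off-diagonal entries (x_1 ≠ y_1 and x_2 ≠ y_2), since it is false for diagonal ones: with V={x,y}, c_xx=c_yy=0, c_xy=1 we have x∼y but c_xx ≠ c_xy. *)

(* Defs.v *)
From HB Require Import structures.
From mathcomp Require Import all_boot all_order all_algebra.
From mathcomp Require Import complex.

Set Implicit Arguments.
Unset Strict Implicit.
Unset Printing Implicit Defensive.

Import Order.TTheory GRing.Theory Num.Theory.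
Local Open Scope ring_scope.

(* A real matrix with rows and columns indexed by a finite type V is given by
   its entries c : V -> V -> R; [mxof c] is the same matrix with V replaced by
   its enumeration. *)
Definition mxof (R : rcfType) (V : finType) (c : V -> V -> R) : 'M[R]_#|V| :=
  \matrix_(i, j) c (enum_val i) (enum_val j).

(* The complex eigenvalues of A, with algebraic multiplicity. *)
Definition eigenvalues (R : rcfType) (n : nat) (A : 'M[R]_n) : seq R[i] :=
  sval (closed_field_poly_normal (char_poly (map_mx (real_complex R) A))).

Lemma eigenvaluesP (R : rcfType) (n : nat) (A : 'M[R]_n) :
  char_poly (map_mx (real_complex R) A)
  = \prod_(z <- eigenvalues A) ('X - z%:P).
Proof.
rewrite /eigenvalues; case: closed_field_poly_normal => r /= {1}->.
by rewrite (monicP (char_poly_monic _)) scale1r.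
Qed.

Definition energy (R : rcfType) (n : nat) (A : 'M[R]_n) : R :=
  \sum_(z <- eigenvalues A) Normc.normc z.

(* max {c v w : w <> v}; when V has no element other than v this takes the
   irrelevant value c v v. *)
Definition offmax (R : rcfType) (V : finType) (c : V -> V -> R) (v : V) : R :=
  let w0 := odflt v [pick w | w != v] in
  c v [arg max_(w > w0 | w != v) c v w]%O.

Lemma offmaxP (R : rcfType) (V : finType) (c : V -> V -> R) (v : V) :
  (1 < #|V|)%N ->
  (exists2 w, w != v & offmax c v = c v w) /\
  (forall w, w != v -> c v w <= offmax c v).
Proof.
move=> V_gt1; rewrite /offmax; case: pickP => [w0 w0v | no_w] /=.
  case: arg_maxP => // w wv max_w; split; first by exists w.
  by move=> u uv; apply: max_w.
move: V_gt1; rewrite ltnNge => /negP[]; rewrite -(card1 v).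
by apply/subset_leq_card/subsetP => w _; have /negbFE := no_w w.
Qed.

Definition sim (R : rcfType) (V : finType) (c : V -> V -> R) : rel V :=
  fun x y => (x == y) || ((offmax c x == c x y) && (offmax c y == c x y)).

(* X_0, ..., X_(k-1) is a partition of V that is equitable for c, with
   equitable quotient matrix Q. Injectivity rules out repeated blocks. *)
Definition equitable_quotient (R : rcfType) (V : finType) (c : V -> V -> R)
    (k : nat) (X : 'I_k -> {set V}) (Q : 'M[R]_k) : Prop :=
  [/\ injective X,
      partition [set X i | i : 'I_k] [set: V]
    & forall i j x, x \in X i -> \sum_(y in X j) c x y = Q i j].

(* Main.v *)
(* If m_i is the common row maximum on the class X_i, then
   C = S B S^T - diag(m(x)) for the indicator matrix S of the classes: C is the
   blow-up of a k x k matrix B, up to a diagonal matrix that is constant on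
   classes. A determinant identity then gives
     chi_C * prod_i (X + m_i) = chi_Q * prod_x (X + m(x)),
   so that the spectrum of C is that of Q together with the eigenvalues - m_i,
   repeated |X_i| - 1 times. As C is symmetric, Q has a real spectrum, and the
   energy of Q exceeds its trace unless no eigenvalue of Q is negative. *)
Require Import Defs.
From HB Require Import structures.
From mathcomp Require Import all_boot all_order all_algebra.
From mathcomp Require Import complex.

Set Implicit Arguments.
Unset Strict Implicit.
Unset Printing Implicit Defensive.

Import Order.TTheory GRing.Theory Num.Theory.
Local Open Scope ring_scope.

(* A variant of Sylvester's determinant identity that avoids inverting X - D:
   both sides are the determinant of
   [[X - D, S], [T, 1]] * [[1, - S], [0, X - E]]. *)
Lemma char_poly_intertwine (R : comNzRingType) (n k : nat) (D : 'M[R]_n)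
    (E : 'M[R]_k) (S : 'M[R]_(n, k)) (T : 'M[R]_(k, n)) :
  D *m S = S *m E ->
  char_poly (D + S *m T) * char_poly E = char_poly D * char_poly (E + T *m S).
Proof.
move=> DS; pose S' := map_mx polyC S; pose T' := map_mx polyC T.
pose A := block_mx (char_poly_mx D) S' T' 1%:M.
have xDS : char_poly_mx D *m S' = S' *m char_poly_mx E.
  rewrite /char_poly_mx mulmxBl mulmxBr -!map_mxM DS.
  by rewrite mul_scalar_mx mul_mx_scalar.
have detA : \det A = char_poly (D + S *m T).
  have -> : A = block_mx (char_poly_mx (D + S *m T)) S' 0 1%:M
                *m block_mx 1%:M 0 T' 1%:M.
    rewrite mulmx_block !mulmx1 !mul0mx !mul1mx mulmx0 !add0r /A.
    by rewrite /char_poly_mx map_mxD map_mxM opprD addrA subrK.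
  by rewrite det_mulmx det_ublock det_lblock !det1 !mulr1.
(* By [xDS] the upper right block of this product vanishes. *)
have <- : \det (A *m block_mx 1%:M (- S') 0 (char_poly_mx E))
          = char_poly D * char_poly (E + T *m S).
  rewrite mulmx_block !mulmx1 !mulmx0 !addr0 mul1mx !mulmxN xDS.
  rewrite [X in block_mx _ X]addNr det_lblock /char_poly; congr (_ * \det _).
  by rewrite /char_poly_mx map_mxD map_mxM opprD addrC -addrA.
by rewrite det_mulmx detA det_ublock det1 mul1r.
Qed.

(** * Spectra as multisets, and diagonal matrices *)

Lemma perm_eigenvalues (R : rcfType) (n : nat) (A : 'M[R]_n) (s : seq R[i]) :
  char_poly (map_mx (real_complex R) A) = \prod_(z <- s) ('X - z%:P) ->
  perm_eq (eigenvalues A) s.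
Proof. by rewrite eigenvaluesP => /prod_XsubC_eq. Qed.

(** Over [R[i]] a product of monic linear factors determines its roots with multiplicity. With a
    factor on each side, spectra are compared without dividing polynomials. *)
Lemma perm_eigenvalues_cat (R : rcfType) (m n p q : nat)
    (A : 'M[R]_m) (B : 'M[R]_n) (C : 'M[R]_p) (D : 'M[R]_q) :
  char_poly A * char_poly B = char_poly C * char_poly D ->
  perm_eq (eigenvalues A ++ eigenvalues B) (eigenvalues C ++ eigenvalues D).
Proof.
move=> /(congr1 (map_poly (real_complex R))).
rewrite !rmorphM /= !map_char_poly !eigenvaluesP -!big_cat.
exact: prod_XsubC_eq.
Qed.

Lemma eigenvalues_diag (R : rcfType) (n : nat) (d : 'rV[R]_n) :
  perm_eq (eigenvalues (diag_mx d))
    [seq real_complex R (d 0 i) | i <- enum 'I_n].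
Proof.
apply: perm_eigenvalues; rewrite map_diag_mx char_poly_trig ?diag_mx_is_trig //.
rewrite big_map big_enum; apply: eq_bigr => i _.
by rewrite !mxE eqxx.
Qed.

Lemma energy_diag (R : rcfType) (n : nat) (d : 'rV[R]_n) :
  energy (diag_mx d) = \sum_i `|d 0 i|.
Proof.
rewrite /energy (perm_big _ (eigenvalues_diag d)) big_map big_enum.
by apply: eq_bigr => i _ /=; rewrite expr0n addr0 sqrtr_sqr.
Qed.

Lemma eigenvalues_diag_real (R : rcfType) (n : nat) (d : 'rV[R]_n) :
  {in eigenvalues (diag_mx d), forall z, z \is Num.real}.
Proof.
move=> z; rewrite (perm_mem (eigenvalues_diag d)) => /mapP[i _ ->].
by apply/complex_realP; exists (d 0 i).
Qed.

(** * Real spectra, trace and energy *)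

Lemma mem_eigenvalues (R : rcfType) (n : nat) (A : 'M[R]_n) (z : R[i]) :
  (z \in eigenvalues A) = eigenvalue (map_mx (real_complex R) A) z.
Proof. by rewrite eigenvalue_root_char eigenvaluesP root_prod_XsubC. Qed.

Lemma mem_eigenvalues_real (R : rcfType) (n : nat) (A : 'M[R]_n) (a : R) :
  (real_complex R a \in eigenvalues A) = eigenvalue A a.
Proof.
by rewrite mem_eigenvalues !eigenvalue_root_char -map_char_poly fmorph_root.
Qed.

Lemma eigenvalues_sym_real (R : rcfType) (n : nat) (A : 'M[R]_n) :
  A^T = A -> {in eigenvalues A, forall z, z \is Num.real}.
Proof.
move=> A_sym z; rewrite mem_eigenvalues => /eigenvalueP[v vA v_neq0].
set A' := map_mx _ A in vA.
(* z (v v^* ) = v A v^* = z^* (v v^* ) *)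
pose w := map_mx (@conjc R) v^T; pose N := (v *m w) 0 0.
have A'_real : map_mx (@conjc R) A' = A'.
  by apply/matrixP=> i j; rewrite !mxE /= oppr0.
have A'_sym : A'^T = A' by rewrite /A' map_trmx A_sym.
(* [N] is the sum of the squared moduli of the entries of [v]. *)
have N_neq0 : N != 0.
  apply: contraNneq v_neq0 => N0; apply/eqP/rowP=> i; rewrite mxE.
  have := N0; rewrite /N mxE => /eqP; rewrite psumr_eq0 => [/allP/(_ i)|j _].
    rewrite mem_index_enum !mxE -sqr_normc => /(_ isT) /=.
    by rewrite expf_eq0 normr_eq0 => /eqP.
  by rewrite !mxE -sqr_normc exprn_ge0.
have vAw : (v *m A' *m w) 0 0 = z * N by rewrite vA -scalemxAl mxE.
have wA : A' *m w = conjc z *: w.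
  have -> : A' *m w = map_mx (@conjc R) (v *m A')^T.
    by rewrite trmx_mul map_mxM /= A'_sym A'_real.
  by rewrite vA linearZ /= map_mxZ.
have : z = conjc z.
  by apply: (mulIf N_neq0); rewrite -vAw -mulmxA wA -scalemxAr mxE.
case: (z) => a b [/eqP]; rewrite -subr_eq0 opprK -mulr2n mulrn_eq0 /=.
by rewrite complex_real.
Qed.

(** Up to sign, both sides are the coefficient of X^(n-1) in the characteristic polynomial; for n =
    0 both are empty sums. *)
Lemma trace_eigenvalues (R : rcfType) (n : nat) (A : 'M[R]_n) :
  \sum_(z <- eigenvalues A) z = real_complex R (\tr A).
Proof.
have size_eig : size (eigenvalues A) = n.
  apply: succn_inj.
  by rewrite -(size_prod_XsubC _ id) -eigenvaluesP size_char_poly.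
case: n A size_eig => [|n] A size_eig.
  by rewrite (size0nil size_eig) big_nil /mxtrace big_ord0 rmorph0.
apply: oppr_inj; rewrite -coefPn_prod_XsubC ?size_eig // -eigenvaluesP.
by rewrite char_poly_trace ?trace_map_mx.
Qed.

Lemma normc_real (R : rcfType) (z : R[i]) :
  z \is Num.real -> Normc.normc z = `|complex.Re z|.
Proof.
case: z => a b; rewrite complex_real => /eqP-> /=.
by rewrite expr0n addr0 sqrtr_sqr.
Qed.

(** The gap is the sum of |z| - z over the real eigenvalues; each term is nonnegative and vanishes
    exactly when z >= 0. *)
Lemma trace_le_energy (R : rcfType) (n : nat) (A : 'M[R]_n) :
  {in eigenvalues A, forall z, z \is Num.real} ->
  \tr A <= energy A /\
  (energy A = \tr A <-> ~ (exists a : R, a < 0 /\ eigenvalue A a)).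
Proof.
move=> A_real.
have trE : \tr A = \sum_(z <- eigenvalues A) complex.Re z.
  have := congr1 (@complex.Re R) (trace_eigenvalues A) => /= <-.
  by apply: (big_morph (@complex.Re R)) => [[a b] [c d]|].
have enE : energy A = \sum_(z <- eigenvalues A) `|complex.Re z|.
  by apply: eq_big_seq => z /A_real/normc_real.
have gap : energy A - \tr A
    = \sum_(z <- eigenvalues A) (`|complex.Re z| - complex.Re z).
  by rewrite trE enE sumrB.
have gap_ge0 (z : R[i]) : 0 <= `|complex.Re z| - complex.Re z.
  by rewrite subr_ge0 ler_norm.
split; first by rewrite -subr_ge0 gap sumr_ge0.
split=> [/eqP|no_neg]; last first.
  apply/eqP; rewrite -subr_eq0 gap big_seq big1 // => z z_eig.
  apply/eqP; rewrite subr_eq0 eqr_norm_id leNgt; apply/negP => z_lt0.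
  apply: no_neg; exists (complex.Re z); split=> //.
  by rewrite -mem_eigenvalues_real RRe_real ?A_real.
rewrite -subr_eq0 gap psumr_eq0 // => /allP gap0 [a [a_lt0]].
rewrite -mem_eigenvalues_real => /gap0; rewrite subr_eq0 eqr_norm_id /=.
by rewrite leNgt a_lt0.
Qed.

(** * Spectrum of a blow-up *)

(** With [S] the indicator matrix of the fibres of [f] and [T] = B S^T, [S *m T] is the blow-up of
    [b], while [T *m S] scales each column of [b] by the size of its fibre. *)
Lemma char_poly_blowup (R : rcfType) (V : finType) (k : nat)
    (c : V -> V -> R) (f : V -> 'I_k) (b : 'I_k -> 'I_k -> R) (m : 'I_k -> R) :
  (forall x y, c x y = b (f x) (f y) - m (f x) *+ (x == y)) ->
  char_poly (mxof c) * char_poly (diag_mx (\row_i - m i))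
  = char_poly (diag_mx (\row_(i < #|V|) - m (f (enum_val i)))) *
    char_poly (\matrix_(i, j)
      (b i j * #|[set x | f x == j]|%:R - m i *+ (i == j))).
Proof.
move=> cE; pose S := \matrix_(i < #|V|, j < k) ((f (enum_val i) == j)%:R : R).
pose T := \matrix_(i < k, j < #|V|) b i (f (enum_val j)).
set D := diag_mx (\row_(i < #|V|) _); set E := diag_mx (\row_(i < k) _).
have -> : mxof c = D + S *m T.
  apply/matrixP=> i j; rewrite !mxE cE (inj_eq enum_val_inj) mulNrn addrC.
  congr (_ + _); rewrite (bigD1 (f (enum_val i))) //= !mxE eqxx mul1r.
  rewrite big1 ?addr0 // => l /negPf neq_l.
  by rewrite mxE eq_sym neq_l mul0r.
set Q := \matrix_(i, j) _; have -> : Q = E + T *m S.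
  apply/matrixP=> i j; rewrite !mxE mulNrn addrC; congr (_ + _).
  under eq_bigr do rewrite !mxE.
  rewrite -(big_enum_val (fun x => b i (f x) * (f x == j)%:R)) /=.
  rewrite (bigID (fun x => f x == j)) /= addrC big1 => [|x /negPf->].
    rewrite add0r (eq_bigr (fun=> b i j)) => [|x /eqP->].
      by rewrite sumr_const mulr_natr cardsE.
    by rewrite eqxx mulr1.
  by rewrite mulr0.
(* Both products have entry - m (f x) at (x, f x) and zeros elsewhere. *)
apply: char_poly_intertwine; rewrite mul_diag_mx mul_mx_diag.
apply/matrixP=> i j; rewrite !mxE mulrC.
by case: eqP => [->|_]; rewrite ?mul0r.
Qed.

(** * The relation [sim] and its classes *)

Lemma le_offmax (R : rcfType) (V : finType) (c : V -> V -> R) (x y : V) :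
  x != y -> c x y <= offmax c x.
Proof.
move=> xy; have V_gt1 : (1 < #|V|)%N by apply/card_gt1P; exists x, y.
by have [_ ->//] := offmaxP c x V_gt1; rewrite eq_sym.
Qed.

Lemma sim_offmax (R : rcfType) (V : finType) (c : V -> V -> R) (x y : V) :
  sim c x y -> offmax c x = offmax c y.
Proof. by case/orP=> [/eqP->|/andP[/eqP-> /eqP->]]. Qed.

Lemma sim_entry (R : rcfType) (V : finType) (c : V -> V -> R) (x y : V) :
  sim c x y -> x != y -> c x y = offmax c x.
Proof. by case/orP=> [/eqP->|/andP[/eqP-> _]]; rewrite ?eqxx. Qed.

Lemma sim_refl (R : rcfType) (V : finType) (c : V -> V -> R) :
  reflexive (sim c).
Proof. by move=> x; rewrite /sim eqxx. Qed.

Lemma sim_sym (R : rcfType) (V : finType) (c : V -> V -> R) :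
  (forall x y, c x y = c y x) -> symmetric (sim c).
Proof. by move=> c_sym x y; rewrite /sim eq_sym c_sym andbC. Qed.

Lemma sim_trans (R : rcfType) (V : finType) (c : V -> V -> R) :
  (forall x y, c x y = c y x) ->
  (forall x y z, x != y -> y != z -> x != z ->
     Num.min (c x y) (c y z) <= c x z) ->
  transitive (sim c).
Proof.
move=> c_sym c_min y x z sxy syz.
have [->//|xy] := eqVneq x y; have [<-//|yz] := eqVneq y z.
have [->|xz] := eqVneq x z; first exact: sim_refl.
have mxy := sim_offmax sxy; have myz := sim_offmax syz.
have cxz : c x z = offmax c x.
  (* Both entries in the minimum equal the common row maximum, so [c x z] is at least that
     maximum. *)
  apply/le_anti; rewrite le_offmax //=.
  have := c_min x y z xy yz xz.
  by rewrite (sim_entry sxy) // (sim_entry syz) // -mxy minxx.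
by rewrite /sim cxz mxy myz eqxx orbT.
Qed.

(** For distinct equivalent u, v the entry [c v u] is the maximum of row u, so the minimum of
    [c v u] and [c u y] is [c u y], a lower bound for [c v y]. Exchanging u and v gives equality. *)
Lemma sim_row (R : rcfType) (V : finType) (c : V -> V -> R) (x1 x2 y : V) :
  (forall x y, c x y = c y x) ->
  (forall x y z, x != y -> y != z -> x != z ->
     Num.min (c x y) (c y z) <= c x z) ->
  sim c x1 x2 -> x1 != y -> x2 != y -> c x1 y = c x2 y.
Proof.
move=> c_sym c_min.
suff le_row u v : sim c u v -> u != y -> v != y -> c u y <= c v y.
  move=> s12 x1y x2y; apply/le_anti/andP.
  by split; apply: le_row => //; rewrite sim_sym.
move=> suv uy vy; have [->//|uv] := eqVneq u v.
apply: le_trans (c_min v u y _ uy vy); last by rewrite eq_sym.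
by rewrite le_min lexx andbT (c_sym v) (sim_entry suv uv) le_offmax.
Qed.

Lemma sim_congr (R : rcfType) (V : finType) (c : V -> V -> R)
    (x1 x2 y1 y2 : V) :
  (forall x y, c x y = c y x) ->
  (forall x y z, x != y -> y != z -> x != z ->
     Num.min (c x y) (c y z) <= c x z) ->
  sim c x1 x2 -> sim c y1 y2 -> x1 != y1 -> x2 != y2 -> c x1 y1 = c x2 y2.
Proof.
(* The endpoints are replaced one at a time, through the entry at (x2, y1). If x2 = y1, that entry
   is diagonal, but then all four points lie in one class and both entries are its row maximum. *)
move=> c_sym c_min sx sy n1 n2; have [x2y1|x2y1] := eqVneq x2 y1.
  rewrite -x2y1 in sy n1 *.
  by rewrite (sim_entry sx n1) (sim_entry sy n2) (sim_offmax sx).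
rewrite (sim_row c_sym c_min sx n1 x2y1) !(c_sym x2).
by apply: sim_row sy _ _; rewrite // eq_sym.
Qed.

(** Replaces the indexed family of classes by a class map [f] and a choice [r] of representatives;
    injectivity of [X] makes the index of a class unique. *)
Lemma equivalence_partition_index (V : finType) (e : rel V) (k : nat)
    (X : 'I_k -> {set V}) :
  equivalence_rel e -> injective X ->
  [set X i | i : 'I_k] = equivalence_partition e [set: V] ->
  exists (f : V -> 'I_k) (r : 'I_k -> V),
    [/\ forall x i, (x \in X i) = (f x == i), cancel r f
      & forall x y, e x y = (f x == f y)].
Proof.
move=> eq_e X_inj XE.
have class_eq x y : e x y -> e x =1 e y by move=> exy z; apply: (eq_e x y z).2.
have Xf x : exists i, X i = [set y in [set: V] | e x y].
  have : [set y in [set: V] | e x y] \in [set X i | i : 'I_k].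
    by rewrite XE; apply: imset_f.
  by case/imsetP => i _ ->; exists i.
have rX i : exists x, X i = [set y in [set: V] | e x y].
  have : X i \in equivalence_partition e [set: V] by rewrite -XE imset_f.
  by case/imsetP => x _ ->; exists x.
have [f fP] := fin_all_exists Xf; have [r rP] := fin_all_exists rX.
have mem_X x i : (x \in X i) = (f x == i).
  apply/idP/eqP=> [|<-]; last by rewrite fP !inE (eq_e x x x).1.
  rewrite rP !inE /= => /class_eq e_rx; apply: X_inj; rewrite fP rP.
  by apply/setP=> y; rewrite !inE e_rx.
exists f, r; split=> // [i|x y].
  by apply/eqP; rewrite -mem_X rP !inE (eq_e (r i) (r i) (r i)).1.
by rewrite eq_sym -mem_X fP !inE.
Qed.

(** * Assembly of the four claims *)

Theorem theorem7 (R : rcfType) (V : finType) (c : V -> V -> R)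
    (V_ge2 : (2 <= #|V|)%N)
    (c_sym : forall x y, c x y = c y x)
    (c_min : forall x y z, x != y -> y != z -> x != z ->
       Num.min (c x y) (c y z) <= c x z) :
  (* (1) *)
  [/\ reflexive (sim c), symmetric (sim c) & transitive (sim c)] /\
  (* (2) *)
  (forall x1 x2 y1 y2, sim c x1 x2 -> sim c y1 y2 ->
     x1 != y1 -> x2 != y2 -> c x1 y1 = c x2 y2) /\
  (forall (k : nat) (X : 'I_k -> {set V}),
     injective X ->
     [set X i | i : 'I_k] = equivalence_partition (sim c) [set: V] ->
     (forall x y, sim c x y -> c x x = c y y) ->
     (* (3) *)
     (exists Q : 'M[R]_k,
        [/\ equitable_quotient c X Q,
            forall i j x y, i != j -> x \in X i -> y \in X j ->
              Q i j = c x y * #|X j|%:R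
          & forall j x, x \in X j ->
              Q j j = c x x + offmax c x * (#|X j|%:R - 1)]) /\
     (* (4) *)
     ((forall x y, 0 <= c x y) ->
      (forall x, c x x = 0) ->
      forall Q : 'M[R]_k, equitable_quotient c X Q ->
      exists mX : 'I_k -> R,
        [/\ forall i x, x \in X i -> offmax c x = mX i,
            energy (mxof c) = energy Q + \tr Q,
            energy (mxof c) >= 2 * \sum_(i < k) (#|X i|%:R - 1) * mX i
          & energy (mxof c) = 2 * \sum_(i < k) (#|X i|%:R - 1) * mX i <->
            ~ (exists a : R, a < 0 /\ eigenvalue Q a)])).
Proof.
have s_refl := sim_refl c; have s_sym := sim_sym c_sym.
have s_trans := sim_trans c_sym c_min.
split; first by [].
split=> [x1 x2 y1 y2|k X X_inj XE c_diag]; first exact: sim_congr.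
have s_eqv : equivalence_rel (sim c).
  by apply/equivalence_relP; split=> // x y sxy; apply: (left_trans s_sym).
have [f [r [mem_X rK simE]]] := equivalence_partition_index s_eqv X_inj XE.
have XfE j : X j = [set x | f x == j] by apply/setP=> x; rewrite inE mem_X.
pose m i := offmax c (r i).
have sim_r x : sim c x (r (f x)) by rewrite simE rK.
have mE x : offmax c x = m (f x) by apply: sim_offmax.
(* The diagonal value [m i] is the entry between distinct points of a class, and it remains
   meaningful for a singleton class. *)
pose b i j := if i == j then m i else c (r i) (r j).
have cE x y : c x y = b (f x) (f y) - (m (f x) - c x x) *+ (x == y).
  have [<-|xy] := eqVneq x y; first by rewrite /b eqxx subKr.
  rewrite subr0 /b -simE; case: ifPn => sxy; first by rewrite -mE sim_entry.
  apply: sim_congr => //; apply: contraNneq sxy => rxy.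
  by rewrite simE -[f x]rK rxy rK.
have row_sum x j : \sum_(y in X j) c x y
    = b (f x) j * #|X j|%:R - (m (f x) - c x x) *+ (f x == j).
  under eq_bigr do rewrite cE; rewrite sumrB; congr (_ - _).
    rewrite (eq_bigr (fun=> b (f x) j)) => [|y].
      by rewrite sumr_const mulr_natr.
    by rewrite mem_X => /eqP->.
  rewrite -mem_X; case: (boolP (x \in X j)) => xj.
    rewrite (bigD1 x) //= eqxx big1 ?addr0 // => y /andP[_ /negPf].
    by rewrite eq_sym => ->.
  by rewrite big1 // => y yj; case: eqP xj => // ->; rewrite yj.
split.
  (* Row sums are read off at representatives; [c_diag] makes them independent of that choice. *)
  exists (\matrix_(i, j) \sum_(y in X j) c (r i) y); split.
  - split=> // [|i j x].
      by rewrite XE; apply: equivalence_partitionP => x y z _ _ _.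
    rewrite mem_X mxE !row_sum rK => /eqP<-.
    by rewrite (c_diag _ _ (sim_r x)).
  - move=> i j x y ij; rewrite !mem_X => /eqP fx /eqP fy.
    rewrite mxE row_sum rK (negPf ij) subr0; congr (_ * _).
    rewrite cE fx fy; case: eqP => [xy|]; last by rewrite subr0.
    by rewrite -fx -fy xy eqxx in ij.
  - move=> j x; rewrite mem_X => /eqP fx.
    rewrite mxE row_sum rK eqxx /b eqxx mulr1n mE fx.
    rewrite -fx -(c_diag _ _ (sim_r x)) mulrBr mulr1 opprB addrC.
    by rewrite addrAC addrA.
move=> c_ge0 c_diag0 Q [_ _ Q_sum].
have QE : Q = \matrix_(i, j) (b i j * #|X j|%:R - m i *+ (i == j)).
  apply/matrixP=> i j; rewrite mxE -(Q_sum i j (r i)) ?mem_X ?rK //.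
  by rewrite row_sum rK c_diag0 subr0.
have trQ : \tr Q = \sum_(i < k) (#|X i|%:R - 1) * m i.
  apply: eq_bigr => i _; rewrite QE mxE /b eqxx mulr1n.
  by rewrite mulrBl mul1r mulrC.
(* As [V] has at least two elements, [m i] is an actual entry of [c]. *)
have m_ge0 i : 0 <= m i.
  have [[w _ ->] _] := offmaxP c (r i) V_ge2; exact: c_ge0.
set D := diag_mx (\row_(i < #|V|) - m (f (enum_val i))).
set E := diag_mx (\row_(i < k) - m i).
have perm_spec : perm_eq (eigenvalues (mxof c) ++ eigenvalues E)
    (eigenvalues D ++ eigenvalues Q).
  apply: perm_eigenvalues_cat; rewrite /E (@char_poly_blowup _ _ _ _ f b m).
    congr (_ * char_poly _); rewrite QE.
    by apply/matrixP=> i j; rewrite !mxE XfE.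
  by move=> x y; rewrite [LHS]cE c_diag0 subr0.
have enE : energy E = \sum_(i < k) m i.
  by rewrite energy_diag; apply: eq_bigr => i _; rewrite mxE normrN ger0_norm.
have enD : energy D = \sum_(i < k) #|X i|%:R * m i.
  rewrite energy_diag.
  rewrite (eq_bigr (fun i => m (f (enum_val i)))) => [|i _]; last first.
    by rewrite mxE normrN ger0_norm.
  rewrite -(big_enum_val (fun x => m (f x))) /=.
  rewrite (partition_big f xpredT) //=; apply: eq_bigr => j _.
  rewrite (eq_bigr (fun=> m j)) => [|x /eqP-> //].
  by rewrite sumr_const mulr_natl XfE cardsE.
(* The energies of [D] and [E] differ by exactly the trace of [Q]. *)
have en_c : energy (mxof c) = energy Q + \tr Q.
  have : energy (mxof c) + energy E = energy D + energy Q.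
    by rewrite /energy -!big_cat (perm_big _ perm_spec).
  rewrite enE enD trQ => /(canRL (addrK _)) ->.
  rewrite addrAC addrC; congr (_ + _); rewrite -sumrB.
  by apply: eq_bigr => i _; rewrite mulrBl mul1r.
(* [Q] may fail to be symmetric; its eigenvalues are real because each is one of the symmetric
   matrix [mxof c] or of the diagonal matrix [E]. *)
have Q_real : {in eigenvalues Q, forall z, z \is Num.real}.
  move=> z zQ; have : z \in eigenvalues D ++ eigenvalues Q.
    by rewrite mem_cat zQ orbT.
  rewrite -(perm_mem perm_spec) mem_cat => /orP[|].
    apply: eigenvalues_sym_real.
    by apply/matrixP=> i j; rewrite !mxE c_sym.
  exact: eigenvalues_diag_real.
have [le_tr eq_tr] := trace_le_energy Q_real.
(* The bound is twice the trace of [Q], so cancelling one trace leaves the comparison of [energy Q]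
   with [\tr Q]. *)
exists m; rewrite -trQ en_c mulr_natl mulr2n; split=> //.
- by move=> i x; rewrite mem_X => /eqP<-.
- by rewrite lerD2r.
- by rewrite -eq_tr; split=> [/addIr|->].
Qed.
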